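(* Let $\mathbb{H}$ be a Hilbert space over $K\in\{\mathbb{R},\mathbb{C}\}$ (not necessarily finite dimensional). Suppose $T\in \mathbb{L}(\mathbb{H})$ is such that $\|T\|=1$, $M_T=S_{H_0}$, where $H_0$ is a finite dimensional subspace of $\mathbb{H}$, and $\|T\|_{H_0^\perp}<\|T\|$. Then for any subspace $\mathcal{W}$ of $\mathbb{L}(\mathbb{H})$, $T\perp_B \mathcal{W}$ if and only if there exist $n\in\mathbb{N}$, $x_1,x_2,\ldots,x_n\in M_T$ and real numbers $\lambda_1,\lambda_2,\ldots,\lambda_n>0$ such that $\sum_{i=1}^n\lambda_i=1$ and $\sum_{i=1}^n\lambda_i\langle Ax_i,Tx_i\rangle=0$ for all $A\in \mathcal{W}$.
   Context: $\mathbb{L}(\mathbb{H})$ is the space of all bounded linear operators on $\mathbb{H}$ with the operator norm. $S_{H_0}=\{x\in H_0:\|x\|=1\}$ and $M_T=\{x\in \mathbb{H}:\|x\|=1,\ \|Tx\|=\|T\|\}$. $\|T\|_{H_0^\perp}$ denotes the norm of the restriction of $T$ to the orthogonal complement $H_0^\perp$, i.e. $\sup\{\|Tx\|: x\in H_0^\perp,\ \|x\|\le 1\}$. Birkhoff-James orthogonality: $T\perp_B A$ means $\|T+\lambda A\|\geq\|T\|$ for all $\lambda\in K$; for a subspace $\mathcal{W}$ of $\mathbb{L}(\mathbb{H})$, $T\perp_B\mathcal{W}$ means $T\perp_B A$ for all $A\in\mathcal{W}$. The subspace $\mathcal{W}$ need not be closed or finite dimensional. The inner product is linear in the first argument. 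*)

(* Defs.v *)
From HB Require Import structures.
From mathcomp Require Import all_boot all_order all_algebra.
From mathcomp Require Import sesquilinear complex.
From mathcomp Require Import all_classical all_reals topology normedtype.

Set Implicit Arguments.
Unset Strict Implicit.
Unset Printing Implicit Defensive.

Import Order.TTheory GRing.Theory Num.Theory.
Import numFieldNormedType.Exports.
Local Open Scope classical_set_scope.
Local Open Scope ring_scope.

Variant scalar_kind := RealScalars | ComplexScalars.

Definition scalars (R : realType) (k : scalar_kind) : numFieldType :=
  match k with
  | RealScalars => R
  | ComplexScalars => R[i]
  end.

Definition conjK (R : realType) (k : scalar_kind) :
    {rmorphism scalars R k -> scalars R k} :=
  match k with
  | RealScalars => idfun
  | ComplexScalars => @conjc R
  end.

Definition ReK (R : realType) (k : scalar_kind) : scalars R k -> R :=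
  match k with
  | RealScalars => id
  | ComplexScalars => @complex.Re R
  end.

Definition ofR (R : realType) (k : scalar_kind) : R -> scalars R k :=
  match k with
  | RealScalars => id
  | ComplexScalars => real_complex R
  end.
Arguments ofR {R} k _.

Section Subspaces.
Variables (K : numFieldType) (V : lmodType K).

Definition linear_subspace (W : set V) : Prop :=
  W 0 /\ forall (a : K) (u v : V), W u -> W v -> W (a *: u + v).

Definition finite_dim_subspace (W : set V) : Prop :=
  exists (n : nat) (b : 'I_n -> V),
    W = [set x | exists c : 'I_n -> K, x = \sum_(i < n) c i *: b i].

End Subspaces.

Section Operators.
Variables (R : realType) (k : scalar_kind).
Local Notation K := (scalars R k).
Variable H : completeNormedModType K.
Variable dot : {dot H for conjK R k}.

(* The norm of a normed module over K has values in K; it is a nonnegative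
   real element of K, so taking the real part loses nothing. *)
Definition normR (x : H) : R := ReK `|x|.

Definition bounded_operators : set (H -> H) :=
  [set T | linear T /\ exists M : R, forall x, normR (T x) <= M * normR x].

(* [sup] is 0 on sets with no upper bound, so this is the norm of T restricted
   to the subspace A only when T is bounded. *)
Definition opnorm_on (A : set H) (T : H -> H) : R :=
  sup [set normR (T x) | x in A `&` [set x | normR x <= 1]].

Definition opnorm (T : H -> H) : R := opnorm_on [set: H] T.

Definition unit_sphere (A : set H) : set H := A `&` [set x | normR x = 1].

Definition norm_attainment (T : H -> H) : set H :=
  [set x | normR x = 1 /\ normR (T x) = opnorm T].

Definition orthocomplement (A : set H) : set H :=
  [set x | forall y, A y -> dot x y = 0].

Definition BJ_orthogonal (T A : H -> H) : Prop :=
  forall lam : K, opnorm T <= opnorm (T + lam *: A).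

Definition BJ_orthogonal_to (T : H -> H) (W : set (H -> H)) : Prop :=
  forall A, W A -> BJ_orthogonal T A.

End Operators.

(* Main.v *)
Require Import Defs.
From HB Require Import structures.
From mathcomp Require Import all_boot all_order all_algebra.
From mathcomp Require Import sesquilinear complex.
From mathcomp Require Import all_classical all_reals topology normedtype derive.
From mathcomp Require Import ring lra.

Set Implicit Arguments.
Unset Strict Implicit.
Unset Printing Implicit Defensive.

Import Order.TTheory GRing.Theory Num.Theory.
Import numFieldNormedType.Exports.
Local Open Scope classical_set_scope.
Local Open Scope ring_scope.

(* The converse is a direct expansion of |(T + a A) x_i|^2.  The direct implication takes
   place in the real inner product Re <.,.>.  In an orthonormal basis e of H0, the function
   x |-> Re <A x, T x> on H0 is the
   quadratic form of the matrix (Re <A e_i, T e_j>), so W acts on H0 through a finite dimensional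
   space of matrices, spanned by those of A_1, ..., A_q in W.  The vectors
   (sum_i Re <A_j x_i, T x_i>)_j with sum_i |x_i|^2 = 1 form a compact convex set: stacking the
   coordinates of the x_i in a matrix X they depend only on X^T X, and a Householder reflection
   reduces X to dim H0 rows.  If 0 belongs to this set, the normalised x_i and the weights |x_i|^2
   are the required data.  Otherwise its point of minimal norm gives A in W with
   Re <A u, T u> >= c |u|^2 on H0 for some c > 0.  As T is isometric on H0, T H0 is orthogonal to
   T (H0^perp), and the norm gap on H0^perp makes |T - t A| < 1 for small t > 0, contradicting
   orthogonality. *)

(** * Quadratic forms summed over the rows of a matrix, and Gram matrices *)

Section QuadraticForms.
Variable R : realType.

(** The sum of [x *m G *m x^T] over the rows [x] of [X]. For [G = 1%:M] it is the squared
    Hilbert-Schmidt norm of [X]. *)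
Definition qform (N m : nat) (G : 'M[R]_m) (X : 'M[R]_(N, m)) : R :=
  \tr (X *m G *m X^T).

(** By cyclicity of the trace, the form is the trace of [X^T *m X *m G]. *)
Lemma qform_gram (N N' m : nat) (G : 'M[R]_m)
    (X : 'M[R]_(N, m)) (Y : 'M[R]_(N', m)) :
  X^T *m X = Y^T *m Y -> qform G X = qform G Y.
Proof.
move=> XY; rewrite /qform [LHS]mxtrace_mulC [RHS]mxtrace_mulC.
by rewrite !mulmxA XY.
Qed.

Lemma qform_col_mx (N N' m : nat) (G : 'M[R]_m)
    (X : 'M[R]_(N, m)) (Y : 'M[R]_(N', m)) :
  qform G (col_mx X Y) = qform G X + qform G Y.
Proof. by rewrite /qform tr_col_mx mul_col_mx mul_col_row mxtrace_block. Qed.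

Lemma qformZ (N m : nat) (G : 'M[R]_m) (a : R) (X : 'M[R]_(N, m)) :
  qform G (a *: X) = a ^+ 2 * qform G X.
Proof.
by rewrite /qform linearZ /= -!scalemxAl -scalemxAr !mxtraceZ mulrA.
Qed.

Lemma qformE (N m : nat) (G : 'M[R]_m) (X : 'M[R]_(N, m)) :
  qform G X = \sum_i \sum_b (\sum_a X i a * G a b) * X i b.
Proof.
apply: eq_bigr => i _; rewrite mxE; apply: eq_bigr => b _.
by rewrite !mxE.
Qed.

Lemma qform_rows (N m : nat) (G : 'M[R]_m) (X : 'M[R]_(N, m)) :
  qform G X = \sum_i qform G (row i X).
Proof.
rewrite qformE; apply: eq_bigr => i _; rewrite qformE big_ord1.
apply: eq_bigr => b _; rewrite mxE; congr (_ * _).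
by apply: eq_bigr => a _; rewrite mxE.
Qed.

Lemma qform1E (N m : nat) (X : 'M[R]_(N, m)) :
  qform 1%:M X = \sum_i \sum_a X i a ^+ 2.
Proof.
rewrite /qform mulmx1; apply: eq_bigr => i _; rewrite mxE.
by apply: eq_bigr => a _; rewrite mxE expr2.
Qed.

Lemma qform1_ge0 (N m : nat) (X : 'M[R]_(N, m)) : 0 <= qform 1%:M X.
Proof.
by rewrite qform1E; apply: sumr_ge0 => i _; apply: sumr_ge0 => a _; rewrite sqr_ge0.
Qed.

Lemma qform1_coef_le (N m : nat) (X : 'M[R]_(N, m)) i a :
  X i a ^+ 2 <= qform 1%:M X.
Proof.
rewrite qform1E (bigD1 i) //= (bigD1 a) //= -addrA lerDl addr_ge0 //.
  by apply: sumr_ge0 => b _; rewrite sqr_ge0.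
by apply: sumr_ge0 => j _; apply: sumr_ge0 => b _; rewrite sqr_ge0.
Qed.

Lemma qform1_eq0 (N m : nat) (X : 'M[R]_(N, m)) :
  (qform 1%:M X == 0) = (X == 0).
Proof.
apply/eqP/eqP => [X0|->]; last by rewrite /qform !mul0mx mxtrace0.
apply/matrixP => i a; rewrite !mxE; apply/eqP; rewrite -sqrf_eq0.
by rewrite eq_le sqr_ge0 andbT -X0 qform1_coef_le.
Qed.

(* Householder reflection sending the first basis vector to a unit vector of
   the left kernel of [X]: it kills the first row without changing [X^T X]. *)
Lemma gram_drop_row (m : nat) (X : 'M[R]_(1 + m, m)) :
  exists Y : 'M[R]_m, Y^T *m Y = X^T *m X.
Proof.
(* [X] has one more row than columns, so its left kernel is nonzero. *)
have [u uX uu] : exists2 u : 'rV[R]_(1 + m), u *m X = 0 & qform 1%:M u = 1.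
  have : kermx X != 0.
    rewrite kermx_eq0 /row_free neq_ltn; apply/orP; left.
    by rewrite (leq_ltn_trans (rank_leq_col X)).
  case/rowV0Pn => v /sub_kermxP vX v0; exists ((Num.sqrt (qform 1%:M v))^-1 *: v).
    by rewrite -scalemxAl vX scaler0.
  have vv : qform 1%:M v != 0 by rewrite qform1_eq0.
  by rewrite qformZ exprVn sqr_sqrtr ?qform1_ge0 // mulVf.
have uuT : u *m u^T = 1%:M.
  by rewrite [u *m _]mx11_scalar -trace_mx11 -{1}[u]mulmx1 -/(qform _ _) uu.
pose e : 'rV[R]_(1 + m) := delta_mx 0 (lshift m 0).
have [Q eQ QQ] : exists2 Q : 'M[R]_(1 + m), e *m Q = u & Q^T *m Q = 1%:M.
  (* If [u = e] the reflection vector [u - e] vanishes, and the identity serves. *)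
  have [->|ue] := eqVneq u e; first by exists 1%:M; rewrite ?mulmx1 ?trmx1 ?mulmx1.
  pose w := u - e.
  have eeT : e *m e^T = 1%:M.
    by rewrite trmx_delta mul_delta_mx; apply/matrixP => i j; rewrite !ord1 !mxE.
  set a := (u *m e^T) 0 0.
  have ueT : u *m e^T = a%:M by rewrite -mx11_scalar.
  have euT : e *m u^T = a%:M by rewrite -[e]trmxK -trmx_mul ueT tr_scalar_mx.
  have wwT : w *m w^T = (2 - 2 * a)%:M.
    rewrite linearB /= mulmxBl !mulmxBr uuT ueT euT eeT.
    by apply/matrixP => i j; rewrite !ord1 !mxE /=; ring.
  have a1 : 2 - 2 * a != 0.
    apply: contra_neq ue => a0; apply/eqP; rewrite -subr_eq0 -qform1_eq0.
    by rewrite /qform mulmx1 wwT a0 mxtrace_scalar mul0rn.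
  (* Here [2 - 2 * a] is the squared norm of [w], so [1 - s w^T w] is the reflection in the
     hyperplane orthogonal to [w]. *)
  pose s := 2 / (2 - 2 * a).
  exists (1%:M - s *: (w^T *m w)).
    have ewT : e *m w^T = (a - 1)%:M by rewrite linearB /= mulmxBr euT eeT -raddfB.
    rewrite mulmxBr mulmx1 -scalemxAr mulmxA ewT mul_scalar_mx scalerA.
    have -> : s * (a - 1) = -1 by rewrite /s; field.
    by rewrite scaleN1r opprK addrC subrK.
  have ww2 : (w^T *m w) *m (w^T *m w) = (2 - 2 * a) *: (w^T *m w).
    by rewrite mulmxA -(mulmxA w^T) wwT mul_mx_scalar -scalemxAl.
  have wT : (w^T *m w)^T = w^T *m w by rewrite trmx_mul trmxK.
  move: (w^T *m w) ww2 wT => Z Z2 ZT.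
  rewrite [(1%:M - _)^T]linearB /= trmx1 linearZ /= ZT.
  rewrite mulmxBl mul1mx mulmxBr mulmx1 -scalemxAl -scalemxAr Z2 !scalerA.
  have -> : s * s * (2 - 2 * a) = s + s by rewrite /s; field.
  by rewrite scalerDl opprB addrK subrK.
(* The first row of [Q *m X] is [e *m Q *m X = u *m X]. *)
have QX0 : usubmx (Q *m X) = 0.
  apply/matrixP => i j; rewrite ord1 !mxE.
  by have /matrixP/(_ 0 j) := uX; rewrite -eQ -mulmxA -rowE !mxE.
exists (dsubmx (Q *m X)).
have : (Q *m X)^T *m (Q *m X) = X^T *m X.
  by rewrite trmx_mul mulmxA -(mulmxA X^T) QQ mulmx1.
rewrite -{1 2}[Q *m X]vsubmxK QX0 tr_col_mx mul_row_col => <-.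
by rewrite trmx0 mul0mx add0r.
Qed.

End QuadraticForms.

Lemma qform_sum (R : realType) (N m : nat) (I : finType) (c : I -> R)
    (G : I -> 'M[R]_m) (X : 'M[R]_(N, m)) :
  qform (\sum_j c j *: G j) X = \sum_j c j * qform (G j) X.
Proof.
rewrite /qform mulmx_sumr mulmx_suml raddf_sum /=; apply: eq_bigr => j _.
by rewrite -scalemxAr -scalemxAl mxtraceZ.
Qed.

(** * Minimisation on the unit sphere, separation from zero, finite spanning families *)

Lemma continuous_sumr (R : realType) (V : topologicalType) (I : Type) (r : seq I)
    (F : I -> V -> R) :
  (forall i, continuous (F i)) -> continuous (fun x => \sum_(i <- r) F i x).
Proof.
move=> cF; elim: r => [|i r IH] x.
  under eq_fun do rewrite big_nil; exact: cst_continuous.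
under eq_fun do rewrite big_cons; apply: cvgD; [exact: cF|exact: IH].
Qed.

Lemma qform_vec_continuous (R : realType) (N m : nat) (G : 'M[R]_m) :
  continuous (fun v : 'rV[R]_(N * m) => qform G (vec_mx v)).
Proof.
have cc (i : 'I_N) (a : 'I_m) : continuous (fun v : 'rV[R]_(N * m) => vec_mx v i a).
  move=> v; under eq_fun do rewrite mxE; exact: coord_continuous.
under eq_fun do rewrite qformE.
apply: (@continuous_sumr R _ _ _
  (fun i (v : 'rV[R]_(N * m)) => \sum_b (\sum_a vec_mx v i a * G a b) * vec_mx v i b)) => i.
apply: (@continuous_sumr R _ _ _
  (fun b (v : 'rV[R]_(N * m)) => (\sum_a vec_mx v i a * G a b) * vec_mx v i b)) => b.
have cs : continuous (fun v : 'rV[R]_(N * m) => \sum_a vec_mx v i a * G a b).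
  apply: (@continuous_sumr R _ _ _
    (fun a (v : 'rV[R]_(N * m)) => vec_mx v i a * G a b)) => a v.
  exact (continuousM (cc i a v) (@cst_continuous _ _ (G a b) v)).
by move=> v; exact (continuousM (cs v) (cc i b v)).
Qed.

(** The extreme value theorem is applied on the unit sphere, with matrices flattened to row vectors
    by [mxvec]. The sphere is nonempty because both dimensions are positive. *)
Lemma qform_sphere_min (R : realType) (N m : nat) (I : finType) (G : I -> 'M[R]_m) :
  (0 < m)%N ->
  exists2 X : 'M[R]_(N.+1, m), qform 1%:M X = 1 &
    forall Y : 'M[R]_(N.+1, m), qform 1%:M Y = 1 ->
      \sum_j qform (G j) X ^+ 2 <= \sum_j qform (G j) Y ^+ 2.
Proof.
case: m G => // m G _.
pose A := [set v : 'rV[R]_(N.+1 * m.+1) | qform 1%:M (vec_mx v) = 1].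
pose f (v : 'rV[R]_(N.+1 * m.+1)) := \sum_j qform (G j) (vec_mx v) ^+ 2.
have A0 : A !=set0.
  exists (mxvec (delta_mx ord0 ord0)); rewrite /A /= mxvecK /qform mulmx1.
  rewrite trmx_delta mul_delta_mx /mxtrace (bigD1 ord0) //= mxE big1 ?addr0 //.
  by move=> i /negPf i0; rewrite mxE i0.
have cA : compact A.
  apply: bounded_closed_compact.
    exists 1; split; first exact: num_real.
    move=> M M1 v vA /=; rewrite (le_trans _ (ltW M1)) //.
    rewrite [`|v|]mx_normrE; apply/bigmax_leP; split => //= -[i j] _ /=.
    rewrite ord1 -(@ler_pXn2r _ 2) ?nnegrE // expr1n real_normK ?num_real //.
    rewrite -vA; case/mxvec_indexP: j => i' j'.
    have -> : v 0 (mxvec_index i' j') = vec_mx v i' j' by rewrite mxE.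
    exact: qform1_coef_le.
  rewrite /A; have := @closed_comp _ _ (fun v : 'rV[R]_(N.+1 * m.+1) =>
    qform 1%:M (vec_mx v)) [set 1]; apply; last exact: closed_eq.
  by move=> v _; exact: qform_vec_continuous.
have cf : {within A, continuous f}.
  apply: continuous_subspaceT; apply: (@continuous_sumr R _ _ _
    (fun j (v : 'rV[R]_(N.+1 * m.+1)) => qform (G j) (vec_mx v) ^+ 2)) => j v.
  have cq := @qform_vec_continuous R N.+1 m.+1 (G j) v.
  exact (continuousM cq cq).
have [v /set_mem vA vmin] := EVT_min_rV A0 cA cf.
exists (vec_mx v) => // Y Y1.
have := vmin (mxvec Y); rewrite /f mxvecK; apply; apply/mem_set.
by rewrite /A /= mxvecK.
Qed.

(* The vectors [(qform (G j) X)_j], [X] of Hilbert-Schmidt norm 1, form a convex set because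
   [gram_drop_row] frees a row for one more vector; a nonzero point of minimal norm then
   separates it from 0. *)
Lemma qform_alternative (R : realType) (m : nat) (I : finType) (G : I -> 'M[R]_m) :
  (0 < m)%N ->
  (exists2 X : 'M[R]_(m.+1, m), qform 1%:M X = 1 & forall j, qform (G j) X = 0) \/
  (exists (p : I -> R) (c : R), 0 < c /\
    forall y : 'rV[R]_m, c * qform 1%:M y <= \sum_j p j * qform (G j) y).
Proof.
move=> m0; have [X X1 Xmin] := @qform_sphere_min R m m I G m0.
have [Y YX] := @gram_drop_row R m X.
have qYX G' : qform G' Y = qform G' X by exact: qform_gram.
set c := \sum_j qform (G j) X ^+ 2 in Xmin.
have c_ge0 : 0 <= c by apply: sumr_ge0 => j _; exact: sqr_ge0.
have [c0|c_neq0] := eqVneq c 0.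
  left; exists X => // j; apply/eqP; rewrite -sqrf_eq0.
  by move/eqP: c0; rewrite psumr_eq0 => [/allP/(_ j)|i _];
    [apply; rewrite mem_index_enum|exact: sqr_ge0].
have c_gt0 : 0 < c by rewrite lt_def c_neq0.
(* The separating functional is the inner product with the point of minimal norm itself, and [c] is
   its squared norm. *)
right; exists (fun j => qform (G j) X), c; split => // y.
wlog y1 : y / qform 1%:M y = 1.
  move=> main; have [->|y0] := eqVneq y 0.
    rewrite [qform _ _](_ : _ = 0) ?mulr0; last by apply/eqP; rewrite qform1_eq0.
    rewrite big1 // => j _; rewrite -[0 : 'rV_m](scale0r 0) qformZ expr0n /=.
    by rewrite mul0r mulr0.
  have n_gt0 : 0 < qform 1%:M y by rewrite lt_def qform1_ge0 qform1_eq0 y0.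
  have nE : (Num.sqrt (qform 1%:M y))^-1 ^+ 2 = (qform 1%:M y)^-1.
    by rewrite exprVn sqr_sqrtr ?qform1_ge0.
  have := main ((Num.sqrt (qform 1%:M y))^-1 *: y).
  rewrite qformZ nE mulVf ?gt_eqF // mulr1 => /(_ erefl).
  under eq_bigr do rewrite qformZ nE mulrCA.
  by rewrite -mulr_sumr mulrC ler_pdivlMr.
rewrite y1 mulr1.
set ps := \sum_j _; pose ss := \sum_j qform (G j) y ^+ 2.
(* Stacking [y] on the [m] rows of [Y] with weights [sqrt t] and [sqrt (1 - t)] gives an admissible
   matrix with [m + 1] rows, whose values form the convex combination of those of [y] and [X].
   Minimality of [X] bounds its squared norm below. *)
have step t : 0 <= t -> t <= 1 -> c <= (1 - t) ^+ 2 * c + 2 * t * (1 - t) * ps + t ^+ 2 * ss.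
  move=> t0 t1; pose Z : 'M[R]_(1 + m, m) := col_mx (Num.sqrt t *: y) (Num.sqrt (1 - t) *: Y).
  have qZ G' : qform G' Z = t * qform G' y + (1 - t) * qform G' X.
    by rewrite qform_col_mx !qformZ !sqr_sqrtr ?subr_ge0 // qYX.
  have := Xmin Z; rewrite qZ y1 X1 => /(_ ltac:(ring)) /le_trans; apply.
  rewrite /c /ps /ss !mulr_sumr -!big_split /= le_eqVlt; apply/orP; left; apply/eqP.
  by apply: eq_bigr => j _; rewrite qZ; ring.
rewrite leNgt; apply/negP => psc.
(* The right side of [step] is [c - D t + E t^2]. If [D > 0], it falls below [c] at its minimum
   [t = D / (2 E)], and [step] at 1 yields [D <= E], which keeps this [t] in the unit interval. *)
pose D := 2 * (c - ps); pose E := c - 2 * ps + ss.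
have D0 : 0 < D by rewrite /D; lra.
have DE : D <= E by have := step 1 ler01 (lexx _); rewrite /D /E; lra.
have E0 : 0 < E by lra.
pose t := D / (2 * E).
have tE : t * E = D / 2 by rewrite /t; field; lra.
have t0 : 0 < t by rewrite /t divr_gt0 //; lra.
have t1 : t <= 1 by rewrite /t ler_pdivrMr; lra.
have : 0 <= t * (t * E - D).
  by have := step t (ltW t0) t1; rewrite /D /E; lra.
rewrite pmulr_rge0 // tE; lra.
Qed.

(** Among the matrices with all rows in [U], one of maximal rank spans [U]: a vector of [U] outside
    its row space would raise the rank. It serves to extract finitely many operators from [W] whose
    matrices span those of all of [W]. *)
Lemma linear_set_row_space (F : fieldType) (n : nat) (U : set 'rV[F]_n) :
  U 0 -> (forall a u v, U u -> U v -> U (a *: u + v)) ->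
  exists B : 'M[F]_n, (forall i, U (row i B)) /\ forall u, U u -> (u <= B)%MS.
Proof.
move=> U0 UD.
have Uspan m (M : 'M[F]_(m, n)) w : (forall i, U (row i M)) -> (w <= M)%MS -> U w.
  move=> UM /submxP [c ->]; rewrite mulmx_sum_row.
  elim/big_ind: _ => // [u v Uu Uv|i _]; first by rewrite -[u]scale1r; exact: UD.
  by rewrite -[_ *: _]addr0; exact: UD.
pose P r := `[< exists2 B : 'M[F]_n, \rank B = r & forall i, U (row i B) >].
have Pex : exists r, P r.
  exists 0; apply/asboolP; exists 0; first exact: mxrank0.
  by move=> i; rewrite row0.
have Ple r : P r -> (r <= n)%N by move/asboolP => [B <- _]; exact: rank_leq_col.
case: (ex_maxnP Pex Ple) => r /asboolP [B rB UB] rmax.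
exists B; split => // u Uu; apply: contraT => uB.
(* The matrix representing the sum of row spaces has rows in the span of [col_mx B u], hence in
   [U]. *)
have UBu : forall i, U (row i (B + u)%MS).
  move=> i; apply: (Uspan _ (col_mx B u)).
    move=> j; case: (split_ordP j) => l ->; rewrite ?rowKu ?rowKd //.
    by rewrite ord1; have -> : row 0 u = u by apply/rowP => a; rewrite mxE.
  by rewrite -addsmxE row_sub.
have lt_rank : (r < \rank (B + u)%MS)%N.
  have : (B < B + u)%MS by rewrite ltmxE addsmxSl /= addsmx_sub submx_refl uB.
  by rewrite ltmxErank rB => /andP[].
have /rmax : P (\rank (B + u)%MS) by apply/asboolP; exists (B + u)%MS.
by rewrite leqNgt lt_rank.
Qed.

(** * Real inner product spaces: orthonormal bases, perturbation of a contraction, the real form of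
    the direct implication *)

Section InnerProduct.
Variables (R : realType) (V : lmodType R).

Definition inner_product (d : V -> V -> R) : Prop :=
  [/\ forall u v, d u v = d v u,
      forall a u v w, d (a *: u + v) w = a * d u w + d v w,
      forall u, 0 <= d u u &
      forall u, d u u = 0 -> u = 0].

Variable d : V -> V -> R.
Hypothesis ip : inner_product d.

Lemma ipC u v : d u v = d v u. Proof. by case: ip. Qed.

Lemma ip_ge0 u : 0 <= d u u. Proof. by case: ip. Qed.

Lemma ipDl u v w : d (u + v) w = d u w + d v w.
Proof. by case: ip => _ dP _ _; rewrite -[u]scale1r dP mul1r scale1r. Qed.

Lemma ip0l w : d 0 w = 0.
Proof. by apply: (@addrI _ (d 0 w)); rewrite -ipDl !addr0. Qed.

Lemma ipZl a u w : d (a *: u) w = a * d u w.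
Proof. by case: ip => _ dP _ _; rewrite -[a *: u]addr0 dP ip0l addr0. Qed.

Lemma ipDr u v w : d u (v + w) = d u v + d u w.
Proof. by rewrite ipC ipDl !(ipC _ u). Qed.

Lemma ipZr a u w : d u (a *: w) = a * d u w.
Proof. by rewrite ipC ipZl ipC. Qed.

Lemma ipNl u w : d (- u) w = - d u w.
Proof. by rewrite -scaleN1r ipZl mulN1r. Qed.

Lemma ipNr u w : d u (- w) = - d u w.
Proof. by rewrite ipC ipNl ipC. Qed.

Lemma ip_suml (I : finType) (F : I -> V) w : d (\sum_i F i) w = \sum_i d (F i) w.
Proof. by apply: (big_morph (d^~ w)) => [u v|]; rewrite ?ipDl ?ip0l. Qed.

Lemma ip_sumr (I : finType) (F : I -> V) w : d w (\sum_i F i) = \sum_i d w (F i).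
Proof. by rewrite ipC ip_suml; apply: eq_bigr => i _; rewrite ipC. Qed.

(** Expansion of the squared norm of [a *: u + v], divided by [a]. *)
Lemma ip_young a u v : 0 < a -> - (2 * d u v) <= a * d u u + a^-1 * d v v.
Proof.
move=> a0; have := ip_ge0 (a *: u + v).
rewrite ipDl !ipDr !ipZl !ipZr (ipC v u) => h.
rewrite -subr_ge0 -(pmulr_rge0 _ a0).
have -> : a * (a * d u u + a^-1 * d v v - - (2 * d u v)) =
    a ^+ 2 * d u u + d v v + 2 * a * d u v by field; rewrite gt_eqF.
lra.
Qed.

Lemma linear_sum (f : V -> V) (I : finType) (c : I -> R) (F : I -> V) :
  linear f -> f (\sum_i c i *: F i) = \sum_i c i *: f (F i).
Proof.
move=> lf.
have fD u v : f (u + v) = f u + f v by rewrite -[u]scale1r lf !scale1r.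
have f0 : f 0 = 0 by apply: (@addrI _ (f 0)); rewrite -fD !addr0.
rewrite (big_morph f fD f0); apply: eq_bigr => i _.
by rewrite -[_ *: F i]addr0 lf f0 addr0.
Qed.

(** Gram-Schmidt by induction on [n]. The remainder [r] of the last vector is normalised and
    appended, or dropped if zero, so that [m] may be smaller than [n]. *)
Lemma orthonormal_span n (b : 'I_n -> V) :
  exists m (e : 'I_m -> V), (forall i j, d (e i) (e j) = (i == j)%:R) /\
    forall x, (exists c : 'I_n -> R, x = \sum_i c i *: b i) <->
              (exists y : 'rV[R]_m, x = \sum_i y 0 i *: e i).
Proof.
elim: n b => [|n IH] b.
  exists 0, (fun i => 0); split => [[]//|x]; split => [[c ->]|[y ->]].
    by exists 0; rewrite !big_ord0.
  by exists (fun=> 0); rewrite !big_ord0.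
have [m [e [ee espan]]] := IH (fun i => b (widen_ord (leqnSn n) i)).
set v := b ord_max; pose k : 'rV[R]_m := \row_i d v (e i).
pose r := v - \sum_i k 0 i *: e i.
have vE : v = \sum_i k 0 i *: e i + r by rewrite /r addrC subrK.
have re i : d r (e i) = 0.
  rewrite /r ipDl ipNl ip_suml (bigD1 i) //= ipZl ee eqxx mulr1 mxE big1 ?addr0 ?subrr //.
  by move=> j /negPf ji; rewrite ipZl ee ji mulr0.
clearbody r.
have spanS x : (exists c : 'I_n.+1 -> R, x = \sum_i c i *: b i) <->
    (exists (y : 'rV[R]_m) a, x = \sum_i y 0 i *: e i + a *: r).
  split => [[c ->]|[y [a ->]]].
    have [|y yE] := (espan (\sum_(i < n) c (widen_ord (leqnSn n) i) *:
      b (widen_ord (leqnSn n) i))).1; first by eexists.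
    exists (y + c ord_max *: k), (c ord_max); rewrite big_ord_recr /= yE -/v.
    rewrite {1}vE scalerDr addrA; congr (_ + _).
    rewrite scaler_sumr -big_split /=; apply: eq_bigr => i _.
    by rewrite !mxE scalerDl scalerA.
  have [|c cE] := (espan (\sum_i (y - a *: k) 0 i *: e i)).2; first by eexists.
  (* The coefficients [c] on the first [n] indices, extended by [a] at the last one. Since [v]
     contributes [a *: k] besides [a *: r], the vector [c] was taken for [y - a *: k]. *)
  pose c' (i : 'I_n.+1) := if insub (val i) is Some j then c j else a.
  have c'l j : c' (widen_ord (leqnSn n) j) = c j by rewrite /c' (valK j).
  have c'r : c' ord_max = a by rewrite /c' insubF //= ltnn.
  exists c'; rewrite big_ord_recr c'r /=; under [in RHS]eq_bigr do rewrite c'l.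
  rewrite -cE -/v vE scalerDr addrA; congr (_ + _).
  rewrite scaler_sumr -big_split /=; apply: eq_bigr => i _.
  by rewrite !mxE scalerA -scalerDl subrK.
have [r0|r_neq0] := eqVneq (d r r) 0.
  have {}r0 : r = 0 by case: ip => _ _ _; apply.
  exists m, e; split => // x; rewrite spanS r0; split => [[y [a ->]]|[y ->]].
    by exists y; rewrite scaler0 addr0.
  by exists y, 0; rewrite scaler0 addr0.
pose s := Num.sqrt (d r r).
have s0 : s != 0 by rewrite sqrtr_eq0 -ltNge lt_def r_neq0 ip_ge0.
pose e' (i : 'I_(m + 1)) := match fintype.split i with inl j => e j | inr _ => s^-1 *: r end.
have e'l j : e' (lshift 1 j) = e j by rewrite /e' (unsplitK (inl j)).
have e'r j : e' (rshift m j) = s^-1 *: r by rewrite /e' (unsplitK (inr j)).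
exists (m + 1)%N, e'; split => [i j|x].
  case: (split_ordP i) => i' ->; case: (split_ordP j) => j' ->; rewrite ?e'l ?e'r.
  - by rewrite ee (inj_eq (@lshift_inj _ _)).
  - by rewrite ipZr ipC re mulr0 eq_lrshift.
  - by rewrite ipZl re mulr0 eq_rlshift.
  - rewrite ipZl ipZr (inj_eq (@rshift_inj _ _)) !ord1 eqxx mulrA -expr2 exprVn.
    by rewrite sqr_sqrtr ?ip_ge0 // mulVf.
rewrite spanS; split => [[y [a ->]]|[y ->]].
  exists (row_mx y (a * s)%:M); rewrite big_split_ord /= big_ord1 e'r row_mxEr mxE eqxx.
  rewrite mulr1n scalerA mulfK //; congr (_ + _).
  by apply: eq_bigr => i _; rewrite e'l row_mxEl.
exists (lsubmx y), (rsubmx y 0 0 * s^-1); rewrite big_split_ord /= big_ord1 e'r mxE scalerA.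
by congr (_ + _); apply: eq_bigr => i _; rewrite e'l mxE.
Qed.

(** Contractivity at [t *: z + u] gives [2 t k <= t^2 L] for every real [t], and the linear term
    must then vanish. *)
Lemma contraction_isometry_orth (T : V -> V) u z :
  linear T -> (forall x, d (T x) (T x) <= d x x) ->
  d (T u) (T u) = d u u -> d u z = 0 -> d (T u) (T z) = 0.
Proof.
move=> lT cT uT uz; set k := d _ _; pose L := d z z - d (T z) (T z).
have L0 : 0 <= L by rewrite subr_ge0.
have quad t : 2 * t * k <= t ^+ 2 * L.
  have := cT (t *: z + u); rewrite lT !ipDl !ipDr !ipZl !ipZr uT uz (ipC z u) uz.
  by rewrite (ipC (T z)) -/k /L; lra.
apply/eqP; rewrite -sqrf_eq0 eq_le sqr_ge0 andbT.
have L1 : 0 < L + 1 by lra.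
(* [L] may be zero, hence the denominator [L + 1]. This value of [t] gives
   [2 (L + 1) k^2 <= L k^2]. *)
have := quad (k / (L + 1)).
rewrite -(ler_pM2r (exprn_gt0 2 L1)).
have -> : 2 * (k / (L + 1)) * k * (L + 1) ^+ 2 = 2 * (L + 1) * k ^+ 2 by field; lra.
have -> : (k / (L + 1)) ^+ 2 * L * (L + 1) ^+ 2 = L * k ^+ 2 by field; lra.
have := sqr_ge0 k; nra.
Qed.

(** Write [x = u + z] and expand the squared norm of [T x - t A x]. The cross term gains a multiple
    of [t |u|^2] from [cA]; its loss in [|z|^2] is absorbed by the gap [1 - g], and the term in
    [t^2] is negligible for small [t]. *)
Lemma perturbation_contracts (T A : V -> V) (P : set V) (c g M : R) :
  linear T -> linear A -> (forall x, d (T x) (T x) <= d x x) ->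
  (forall x, exists u z, [/\ x = u + z, P u & forall u', P u' -> d z u' = 0]) ->
  (forall u, P u -> d (T u) (T u) = d u u) ->
  g < 1 -> (forall z, (forall u, P u -> d z u = 0) -> d (T z) (T z) <= g * d z z) ->
  0 < M -> (forall x, d (A x) (A x) <= M * d x x) ->
  0 < c -> (forall u, P u -> c * d u u <= d (A u) (T u)) ->
  exists t q, q < 1 /\ forall x, d (T x - t *: A x) (T x - t *: A x) <= q * d x x.
Proof.
move=> lT lA cT dec isoT g1 gT M0 AM c0 cA.
(* [K] collects the coefficients of [|z|^2] in [cross]: [2 M / c] from each of the two mixed
   products, and [M + 1] from the product of [A z] and [T z]. *)
pose K := 4 * M / c + M + 1.
have K0 : 0 < K by have : 0 < M / c by [exact: divr_gt0]; rewrite /K; lra.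
(* The second bound keeps [t^2 M |u|^2] below half of the gain [t c |u|^2]; the third keeps the
   total loss in [|z|^2] below half of the gap. *)
pose t := Num.min 1 (Num.min (c / (2 * M)) ((1 - g) / (2 * (K + M)))).
have [t0 t1 tc tg] : [/\ 0 < t, t <= 1, t * M <= c / 2 & t * (K + M) <= (1 - g) / 2].
  split.
  - by rewrite !lt_min ltr01 !divr_gt0 //; lra.
  - by rewrite ge_min lexx.
  - have : t <= c / (2 * M) by rewrite !ge_min lexx !orbT.
    by rewrite ler_pdivlMr; lra.
  - have : t <= (1 - g) / (2 * (K + M)) by rewrite !ge_min lexx !orbT.
    by rewrite ler_pdivlMr; lra.
exists t, (Num.max (1 - t * c / 2) ((1 + g) / 2)); split.
  by rewrite gt_max; have := mulr_gt0 t0 c0; lra.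
move=> x; have [u [z [-> Pu zP]]] := dec x.
have uz : d u z = 0 by rewrite ipC zP.
have TD : T (u + z) = T u + T z by rewrite -[u]scale1r lT !scale1r.
have AD : A (u + z) = A u + A z by rewrite -[u]scale1r lA !scale1r.
have Tuz : d (T u) (T z) = 0 by apply: contraction_isometry_orth => //; exact: isoT.
have dx : d (u + z) (u + z) = d u u + d z z by rewrite ipDl !ipDr uz (ipC z) uz; lra.
have dTx : d (T (u + z)) (T (u + z)) <= d u u + g * d z z.
  by rewrite TD ipDl !ipDr Tuz (ipC (T z)) Tuz (isoT u Pu); have := gT z zP; lra.
have dAx := AM (u + z); rewrite dx in dAx.
have cross : - (2 * d (A (u + z)) (T (u + z))) <= - c * d u u + K * d z z.
  rewrite AD TD ipDl !ipDr.
  (* The Young weights make each mixed product cost [c / 2 |u|^2]. Of the gain [2 c |u|^2] given by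
     [cA], there remains [c |u|^2]. *)
  have a0 : 0 < c / (2 * M) by rewrite divr_gt0 //; lra.
  have b0 : 0 < 2 / c by rewrite divr_gt0.
  have h1 := ip_young (A u) (T z) a0.
  have h2 := ip_young (A z) (T u) b0.
  have h3 := ip_young (A z) (T z) ltr01.
  have h4 : c / (2 * M) * d (A u) (A u) <= c / 2 * d u u.
    have -> : c / 2 * d u u = c / (2 * M) * (M * d u u) by field; lra.
    by rewrite ler_pM2l.
  have h5 : (c / (2 * M))^-1 * d (T z) (T z) <= 2 * M / c * d z z.
    by rewrite invf_div ler_pM2l // divr_gt0 //; lra.
  have h6 : 2 / c * d (A z) (A z) <= 2 * M / c * d z z.
    have -> : 2 * M / c * d z z = 2 / c * (M * d z z) by field; lra.
    by rewrite ler_pM2l.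
  have h7 : (2 / c)^-1 * d (T u) (T u) = c / 2 * d u u by rewrite invf_div isoT.
  have h8 := cA u Pu; have h9 := AM z; have h10 := cT z.
  have -> : K * d z z = 2 * M / c * d z z + 2 * M / c * d z z + M * d z z + d z z.
    by rewrite /K; field; lra.
  rewrite invr1 in h3; lra.
rewrite dx; set x' := u + z in dTx dAx cross *.
rewrite ipDl !ipDr !ipNl !ipNr !ipZl !ipZr opprK (ipC (T _) (A _)).
set U := d u u in dTx dAx cross *; set Z := d z z in dTx dAx cross *.
have U0 : 0 <= U by exact: ip_ge0.
have Z0 : 0 <= Z by exact: ip_ge0.
set q := Num.max _ _.
have q1 : (1 - t * c / 2) * U <= q * U by rewrite ler_wpM2r // le_max lexx.
have q2 : (1 + g) / 2 * Z <= q * Z by rewrite ler_wpM2r // le_max lexx orbT.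
have e1 : t * - (2 * d (A x') (T x')) <= t * (- c * U + K * Z) by rewrite ler_pM2l.
have e2 : t * (t * d (A x') (A x')) <= t * (t * (M * (U + Z))) by rewrite !ler_pM2l.
have e3 : t * (t * M) * U <= t * (c / 2) * U by rewrite ler_wpM2r // ler_pM2l.
have e4 : t * (t * M) * Z <= t * M * Z.
  by rewrite ler_wpM2r // ler_piMl // mulr_ge0 ?ltW.
have e5 : t * (K + M) * Z <= (1 - g) / 2 * Z by rewrite ler_wpM2r.
lra.
Qed.

(** Norm conditions appear as inequalities between squared norms, so no operator norm occurs; the
    last hypothesis expresses orthogonality as the absence of a strict contraction [T - A] with [A]
    in [W]. *)
Theorem real_orthogonality_witness (T : V -> V) (H0 : set V) (W : set (V -> V)) (g : R) :
  linear T -> (forall x, d (T x) (T x) <= d x x) ->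
  finite_dim_subspace H0 -> (forall u, H0 u -> d (T u) (T u) = d u u) ->
  g < 1 -> (forall z, (forall u, H0 u -> d z u = 0) -> d (T z) (T z) <= g * d z z) ->
  linear_subspace W -> (forall A, W A -> linear A) ->
  (forall A, W A -> exists2 M, 0 < M & forall x, d (A x) (A x) <= M * d x x) ->
  (forall A q, W A -> q < 1 -> ~ forall x, d (T x - A x) (T x - A x) <= q * d x x) ->
  exists (n : nat) (x : 'I_n -> V) (lam : 'I_n -> R),
    [/\ forall i, H0 (x i) /\ d (x i) (x i) = 1, forall i, 0 < lam i,
        \sum_i lam i = 1 &
        forall A, W A -> \sum_i lam i * d (A (x i)) (T (x i)) = 0].
Proof.
move=> lT cT [n [b H0b]] isoT g1 gT [W0 WD] Wlin Wbd bj.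
have [m [e [ee espan]]] := orthonormal_span b.
pose E (y : 'rV[R]_m) := \sum_i y 0 i *: e i.
have H0E x : H0 x <-> exists y, x = E y by rewrite H0b; exact: espan.
have H0Ey y : H0 (E y) by apply/H0E; exists y.
have dEe y i : d (E y) (e i) = y 0 i.
  rewrite /E ip_suml (bigD1 i) //= ipZl ee eqxx mulr1 big1 ?addr0 //.
  by move=> j /negPf ji; rewrite ipZl ee ji mulr0.
have dE y : d (E y) (E y) = qform 1%:M y.
  rewrite {2}/E ip_sumr qform1E big_ord1; apply: eq_bigr => i _.
  by rewrite ipZr dEe expr2.
have EZ a y : E (a *: y) = a *: E y.
  by rewrite /E scaler_sumr; apply: eq_bigr => i _; rewrite mxE scalerA.
pose G (A : V -> V) : 'M[R]_m := \matrix_(i, j) d (A (e i)) (T (e j)).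
have dG A y : linear A -> d (A (E y)) (T (E y)) = qform (G A) y.
  move=> lA; rewrite qformE big_ord1 /E !linear_sum // ip_sumr; apply: eq_bigr => j _.
  rewrite ipZr ip_suml mulrC; congr (_ * _); apply: eq_bigr => i _.
  by rewrite ipZl mxE.
have dec x : exists u z, [/\ x = u + z, H0 u & forall u', H0 u' -> d z u' = 0].
  pose y : 'rV[R]_m := \row_i d x (e i).
  exists (E y), (x - E y); split => // [|u' /H0E [y' ->]]; first by rewrite addrC subrK.
  rewrite /E ip_sumr big1 // => i _; rewrite ipZr ipDl ipNl -/(E y) dEe mxE.
  by rewrite subrr mulr0.
(* If [H0] were zero, the gap would hold on the whole space and [T - 0] would be a strict
   contraction. *)
have m0 : (0 < m)%N.
  rewrite lt0n; apply/eqP => m0; apply: (bj 0 g W0 g1) => x.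
  change ((0 : V -> V) x) with (0 : V); rewrite subr0.
  apply: gT => u /H0E [y ->]; rewrite ipC /E big1 ?ip0l //.
  by move=> i; exfalso; move: (ltn_ord i); rewrite [X in (_ < X)%N]m0.
pose U := [set mxvec (G A) | A in W].
have [|a _ _ [A WA <-] [B WB <-]|Bm [BU UB]] := @linear_set_row_space R (m * m) U.
- exists 0 => //; apply/eqP; rewrite mxvec_eq0; apply/eqP/matrixP => i j.
  by rewrite !mxE ip0l.
- exists (a *: A + B); first exact: WD.
  rewrite -linearP; congr mxvec; apply/matrixP => i j.
  by rewrite !mxE ipDl ipZl.
have /choice [Aj AjP] : forall j, exists A, W A /\ mxvec (G A) = row j Bm.
  by move=> j; have [A WA AE] := BU j; exists A.
(* In the separated case, the combination of the [Aj] with coefficients [p] is positive definite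
   against [T] on [H0], and a small multiple of it contradicts [bj]. *)
have [[X X1 X0]|[p [c [c0 pc]]]] := qform_alternative (fun j => G (Aj j)) m0; last first.
  pose A := \sum_j p j *: Aj j.
  have WA : W A.
    rewrite /A; elim/big_ind: _ => // [u v Wu Wv|j _].
      by rewrite -[u]scale1r; exact: WD.
    by rewrite -[_ *: _]addr0; apply: WD => //; exact: (AjP j).1.
  have [M M0 AM] := Wbd A WA.
  have cA u : H0 u -> c * d u u <= d (A u) (T u).
    move=> /H0E [y ->]; rewrite dE (le_trans (pc y)) // le_eqVlt; apply/orP; left.
    rewrite /A fct_sumE ip_suml; apply/eqP; apply: eq_bigr => j _.
    by rewrite ipZl dG //; apply: Wlin; exact: (AjP j).1.
  have [t [q [q1 tq]]] := perturbation_contracts lT (Wlin A WA) cT dec isoT g1 gT M0 AM c0 cA.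
  exfalso; apply: (bj (t *: A) q _ q1) => //.
  by rewrite -[_ *: _]addr0; exact: WD.
have GX A : W A -> qform (G A) X = 0.
  move=> WA; have /submxP [k kE] : (mxvec (G A) <= Bm)%MS by apply: UB; exists A.
  have -> : G A = \sum_j k 0 j *: G (Aj j).
    apply: (can_inj mxvecK); rewrite kE mulmx_sum_row raddf_sum; apply: eq_bigr => j _.
    by rewrite /= linearZ /= (AjP j).2.
  by rewrite qform_sum big1 // => j _; rewrite X0 mulr0.
(* Zero rows are discarded because the weights must be positive; the other rows are normalised, with
   their squared norms as weights. *)
pose S := [pred i | row i X != 0].
pose lam i := qform 1%:M (row i X).
have lam_gt0 i : i \in S -> 0 < lam i.
  by rewrite inE => Si; rewrite lt_def qform1_ge0 qform1_eq0 Si.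
have sumS (F : 'I_m.+1 -> R) : (forall i, row i X = 0 -> F i = 0) ->
    \sum_(i < #|S|) F (enum_val i) = \sum_i F i.
  move=> F0; rewrite -big_enum_val [RHS](bigID S) /= [X in _ + X]big1 ?addr0 //.
  by move=> i /negPn/eqP/F0.
exists #|S|, (fun i => E ((Num.sqrt (lam (enum_val i)))^-1 *: row (enum_val i) X)),
  (fun i => lam (enum_val i)).
have sq i : i \in S -> (Num.sqrt (lam i))^-1 ^+ 2 = (lam i)^-1.
  by move=> Si; rewrite exprVn sqr_sqrtr ?qform1_ge0.
split => [i|i||A WA].
- have Si := enum_valP i; split => //.
  by rewrite dE qformZ sq // mulVf // gt_eqF ?lam_gt0.
- exact: lam_gt0 (enum_valP i).
- rewrite sumS -?qform_rows // => i i0.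
  by rewrite /lam i0; apply/eqP; rewrite qform1_eq0.
rewrite -[RHS](GX A WA) qform_rows -sumS.
  apply: eq_bigr => i _; have Si := enum_valP i.
  by rewrite dG ?qformZ ?sq ?mulVKf ?gt_eqF ?lam_gt0 //; exact: Wlin.
by move=> i ->; rewrite /qform !mul0mx mxtrace0.
Qed.

End InnerProduct.

(** * Real and complex scalars, and restriction of scalars to the reals *)

Section Scalars.
Variables (R : realType) (k : scalar_kind).
Local Notation K := (scalars R k).

Lemma ofRD (a b : R) : ofR k (a + b) = ofR k a + ofR k b.
Proof. by case: k => //=; exact: rmorphD. Qed.

Lemma ofRM (a b : R) : ofR k (a * b) = ofR k a * ofR k b.
Proof. by case: k => //=; exact: rmorphM. Qed.

Lemma ofR1 : ofR k 1 = 1 :> K.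
Proof. by case: k. Qed.

Lemma ofR0 : ofR k 0 = 0 :> K.
Proof. by case: k. Qed.

Lemma ReKD (z w : K) : ReK (z + w) = ReK z + ReK w.
Proof. by case: k z w => //= -[a b] [a' b']. Qed.

Lemma ReK0 : ReK (0 : K) = 0.
Proof. by case: k. Qed.

Lemma ReKM (a : R) (z : K) : ReK (ofR k a * z) = a * ReK z.
Proof. by case: k z => //= -[x y] /=; rewrite mul0r subr0. Qed.

Lemma ReK_sum (I : finType) (F : I -> K) : ReK (\sum_i F i) = \sum_i ReK (F i).
Proof. exact: (big_morph (@ReK R k) ReKD ReK0). Qed.

Lemma ReK_conj (z : K) : ReK (conjK R k z) = ReK z.
Proof. by case: k z => //= -[]. Qed.

Lemma conjKK (z : K) : conjK R k (conjK R k z) = z.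
Proof. by case: k z => //= -[x y] /=; rewrite opprK. Qed.

Lemma ReK_ge0 (z : K) : 0 <= z -> 0 <= ReK z.
Proof. by case: k z => //= -[x y]; rewrite lecE /= => /andP[]. Qed.

Lemma ReK_le (z w : K) : z <= w -> ReK z <= ReK w.
Proof. by rewrite -subr_ge0 => /ReK_ge0 zw; rewrite -[w](subrK z) ReKD lerDr. Qed.

Lemma ofR_ReK (z : K) : 0 <= z -> ofR k (ReK z) = z.
Proof. by case: k z => //= -[x y]; rewrite lecE /= => /andP[/eqP -> _]. Qed.

Lemma norm_ofR (a : R) : `|ofR k a| = ofR k `|a|.
Proof. by case: k => //=; rewrite normc_def /= expr0n addr0 sqrtr_sqr. Qed.

(** Taking [w = 1] gives the real part of [z], and [w = -i] its imaginary part. *)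
Lemma ReK_mul_eq0 (z : K) : (forall w, ReK (w * z) = 0) -> z = 0.
Proof.
case: k z => [z /(_ 1)|[x y] h]; first by rewrite mul1r.
have := h 1; rewrite mul1r /= => ->.
by have := h (- 'i)%C; rewrite /= !(mul0r, oppr0, sub0r, mulN1r, opprK) => ->.
Qed.

Lemma scalars_span : exists j : K, forall z : K, exists a b, z = ofR k a + ofR k b * j.
Proof.
case: k => [|]; first by exists 0 => z; exists z, 0; rewrite mulr0 addr0.
exists ('i)%C => -[a b]; exists a, b; apply/eqP; rewrite eq_complex /=.
by rewrite !(mulr0, mulr1, mul0r, subr0, addr0, add0r) !eqxx.
Qed.

End Scalars.

(** A synonym of [H], so that its structure of real vector space does not compete with the one over
    [scalars R k]. *)
Definition realify (R : realType) (k : scalar_kind) (H : lmodType (scalars R k)) : Type := H.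

Section Realify.
Variables (R : realType) (k : scalar_kind) (H : lmodType (scalars R k)).

HB.instance Definition _ := GRing.Zmodule.copy (realify H) H.

Definition realify_scale (a : R) (x : realify H) : realify H := ofR k a *: (x : H).

Lemma realify_scaleA a b v :
  realify_scale a (realify_scale b v) = realify_scale (a * b) v.
Proof. by rewrite /realify_scale scalerA ofRM. Qed.

Lemma realify_scale1 : left_id 1 realify_scale.
Proof. by move=> v; rewrite /realify_scale ofR1 scale1r. Qed.

Lemma realify_scaleDr : right_distributive realify_scale +%R.
Proof. by move=> a u v; rewrite /realify_scale scalerDr. Qed.

Lemma realify_scaleDl v : {morph realify_scale^~ v : a b / a + b}.
Proof. by move=> a b; rewrite /realify_scale ofRD scalerDl. Qed.

HB.instance Definition _ := GRing.Zmodule_isLmodule.Build R (realify H)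
  realify_scaleA realify_scale1 realify_scaleDr realify_scaleDl.

Lemma realify_scaleE (a : R) (x : realify H) : a *: x = ofR k a *: (x : H).
Proof. by []. Qed.

(** If [b] spans over [scalars R k] and [1, j] span the scalars over the reals, then the [b l] and
    [j *: b l] span over the reals. *)
Lemma realify_finite_dim (E : set H) :
  finite_dim_subspace E -> finite_dim_subspace (E : set (realify H)).
Proof.
move=> [n [b ->]]; have [j jspan] := scalars_span R k.
pose b' (i : 'I_(n + n)) : realify H :=
  match fintype.split i with inl l => b l | inr l => j *: b l end.
have b'l l : b' (lshift n l) = b l by rewrite /b' (unsplitK (inl l)).
have b'r l : b' (rshift n l) = j *: b l by rewrite /b' (unsplitK (inr l)).
exists (n + n)%N, b'; apply/seteqP; split => x /= [c ->].
  have /choice [a aP] : forall i, exists a : R * R, c i = ofR k a.1 + ofR k a.2 * j.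
    by move=> i; have [a1 [a2 ->]] := jspan (c i); exists (a1, a2).
  exists (fun i => match fintype.split i with inl l => (a l).1 | inr l => (a l).2 end).
  rewrite big_split_ord /= -big_split; apply: eq_bigr => i _ /=.
  rewrite (unsplitK (inl i)) (unsplitK (inr i)) b'l b'r !realify_scaleE scalerA.
  by rewrite aP scalerDl.
exists (fun i => ofR k (c (lshift n i)) + ofR k (c (rshift n i)) * j).
rewrite big_split_ord /= -big_split; apply: eq_bigr => i _ /=.
by rewrite b'l b'r !realify_scaleE scalerA scalerDl.
Qed.

End Realify.

(** * Real-valued norms and the operator norm *)

Section OperatorNorm.
Variables (R : realType) (k : scalar_kind) (H : completeNormedModType (scalars R k)).

Lemma ofR_normR (x : H) : ofR k (normR x) = `|x|.
Proof. exact: ofR_ReK. Qed.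

Lemma normR_ge0 (x : H) : 0 <= normR x.
Proof. exact: ReK_ge0. Qed.

Lemma normR0 : normR (0 : H) = 0.
Proof. by rewrite /normR normr0 ReK0. Qed.

Lemma normR_eq0 (x : H) : normR x = 0 -> x = 0.
Proof.
by move=> x0; apply: normr0_eq0; rewrite -ofR_normR x0 ofR0.
Qed.

Lemma normRZ (a : R) (x : H) : normR (ofR k a *: x) = `|a| * normR x.
Proof. by rewrite /normR normrZ norm_ofR ReKM. Qed.

Lemma normRZK (a : scalars R k) (x : H) : normR (a *: x) = ReK `|a| * normR x.
Proof. by rewrite /normR normrZ -[X in X * _]ofR_ReK // ReKM. Qed.

Lemma normRD (x y : H) : normR (x + y) <= normR x + normR y.
Proof. by rewrite /normR -ReKD; apply: ReK_le; exact: ler_normD. Qed.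

Lemma bounded_operators_add_scale (B C : H -> H) (a : scalars R k) :
  bounded_operators B -> bounded_operators C -> bounded_operators (B + a *: C).
Proof.
move=> [lB [M BM]] [lC [N CN]]; split => [c u v|].
  rewrite -[LHS]/(B _ + a *: C _) lB lC -[RHS]/(c *: (B u + a *: C u) + (B v + a *: C v)).
  by rewrite !scalerDr !scalerA [a * c]mulrC addrACA.
exists (M + ReK `|a| * N) => x; apply: le_trans (normRD (B x) (a *: C x)) _.
by rewrite normRZK mulrDl lerD // -mulrA ler_wpM2l // ReK_ge0.
Qed.

Lemma linearK0 (f : H -> H) : linear f -> f 0 = 0.
Proof. by move=> lf; apply: (@addrI _ (f 0)); rewrite -{1}[f 0]scale1r -lf scaler0 !addr0. Qed.

Lemma linearKZ (f : H -> H) a x : linear f -> f (a *: x) = a *: f x.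
Proof. by move=> lf; rewrite -[a *: x]addr0 lf linearK0 // addr0. Qed.

(** This makes [opnorm_on] a genuine supremum rather than the default value 0 of [sup]. The bound is
    [|M|], as the sign of [M] is unknown. *)
Lemma opnorm_on_has_ubound (E : set H) (B : H -> H) :
  bounded_operators B ->
  has_ubound [set normR (B x) | x in E `&` [set x | normR x <= 1]].
Proof.
move=> [_ [M BM]]; exists `|M| => _ [x [_ /= x1] <-].
rewrite (le_trans (BM x)) // (le_trans (ler_wpM2r (normR_ge0 x) (ler_norm M))) //.
by rewrite ler_piMr.
Qed.

Lemma opnorm_on_ge0 (E : set H) (B : H -> H) :
  bounded_operators B -> E 0 -> 0 <= opnorm_on E B.
Proof.
move=> bB E0; apply: (le_trans (normR_ge0 (B 0))).
apply: (ub_le_sup (opnorm_on_has_ubound E bB)); exists 0 => //.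
by split => //=; rewrite normR0.
Qed.

Lemma opnorm_onP (E : set H) (B : H -> H) x :
  bounded_operators B -> (forall a y, E y -> E (ofR k a *: y)) -> E x ->
  normR (B x) <= opnorm_on E B * normR x.
Proof.
move=> bB Escale Ex; have lB := bB.1.
have [x0|x0] := eqVneq (normR x) 0.
  by rewrite x0 mulr0 (normR_eq0 x0) linearK0 // normR0.
have x_gt0 : 0 < normR x by rewrite lt_def x0 normR_ge0.
rewrite -ler_pdivrMr // mulrC -[X in X * _]ger0_norm ?invr_ge0 ?normR_ge0 //.
rewrite -normRZ -linearKZ //.
apply: (ub_le_sup (opnorm_on_has_ubound E bB)).
eexists; last by []; split; first exact: Escale.
by rewrite /= normRZ ger0_norm ?invr_ge0 ?normR_ge0 // mulVf.
Qed.

Lemma opnorm_le (B : H -> H) q :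
  0 <= q -> (forall x, normR (B x) <= q * normR x) -> opnorm B <= q.
Proof.
move=> q0 Bq; apply: ge_sup.
  by exists (normR (B 0)), 0 => //; split => //=; rewrite normR0.
by move=> _ [x [_ /= x1] <-]; rewrite (le_trans (Bq x)) // ler_piMr.
Qed.

End OperatorNorm.

(** * The real part of the inner product *)

Section RealPart.
Variables (R : realType) (k : scalar_kind) (H : completeNormedModType (scalars R k)).
Variable dot : {dot H for conjK R k}.
Hypothesis dot_norm : forall x : H, `|x| ^+ 2 = dot x x.

Definition rdot (x y : realify H) : R := ReK (dot x y).

Lemma rdotxx (x : H) : rdot x x = normR x ^+ 2.
Proof. by rewrite /rdot -dot_norm expr2 -{1}ofR_normR ReKM expr2. Qed.

Lemma rdot_inner_product : inner_product rdot.
Proof.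
split => [u v|a u v w|u|u].
- by rewrite /rdot hermC expr0 mul1r ReK_conj.
- by rewrite /rdot linearDl /= ReKD linearZl_LR ReKM.
- by rewrite rdotxx sqr_ge0.
- by rewrite rdotxx => /eqP; rewrite sqrf_eq0 => /eqP; exact: normR_eq0.
Qed.

Lemma bounded_operator_rdot (B : H -> H) :
  bounded_operators B -> exists2 M, 0 < M & forall x, rdot (B x) (B x) <= M * rdot x x.
Proof.
move=> [_ [M BM]]; exists (M ^+ 2 + 1) => [|x]; first by rewrite ltr_wpDl // sqr_ge0.
rewrite !rdotxx (le_trans (lerXn2r 2 _ _ (BM x))) ?nnegrE ?normR_ge0 //.
  by rewrite (le_trans (normR_ge0 _) (BM x)).
by rewrite exprMn ler_wpM2r ?sqr_ge0 // lerDl.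
Qed.

(** Replacing [y] by [conj w *: y] turns the vanishing of real parts into that of the real part of
    [w * dot z y] for every scalar [w]. *)
Lemma rdot_orthocomplement (H0 : set H) z :
  (forall a y, H0 y -> H0 (a *: y)) -> (forall u, H0 u -> rdot z u = 0) ->
  orthocomplement dot H0 z.
Proof.
move=> H0Z zu y H0y; apply: ReK_mul_eq0 => w.
by have := zu _ (H0Z (conjK R k w) y H0y); rewrite /rdot linearZr_LR /= conjKK.
Qed.

Lemma opnorm_rdot (B : H -> H) x : bounded_operators B ->
  rdot (B x) (B x) <= opnorm B ^+ 2 * rdot x x.
Proof.
move=> bB; rewrite !rdotxx -exprMn; apply: lerXn2r; rewrite ?nnegrE ?normR_ge0 //.
  by rewrite mulr_ge0 ?normR_ge0 // opnorm_on_ge0.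
exact: opnorm_onP.
Qed.

End RealPart.

(** * The equivalence over both kinds of scalars *)

Theorem theorem2p8 (R : realType) (k : scalar_kind)
    (H : completeNormedModType (scalars R k))
    (dot : {dot H for conjK R k})
    (dot_norm : forall x : H, `|x| ^+ 2 = dot x x)
    (T : H -> H) (T_bounded : bounded_operators T)
    (H0 : set H) (H0_fin : finite_dim_subspace H0)
    (T_norm : opnorm T = 1)
    (T_attain : norm_attainment T = unit_sphere H0)
    (T_gap : opnorm_on (orthocomplement dot H0) T < opnorm T)
    (W : set (H -> H)) (W_sub : linear_subspace W)
    (W_bounded : W `<=` @bounded_operators R k H) :
  BJ_orthogonal_to T W <->
  exists (n : nat) (x : 'I_n -> H) (lam : 'I_n -> R),
    [/\ forall i, norm_attainment T (x i),
        forall i, 0 < lam i,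
        \sum_(i < n) lam i = 1 &
        forall A, W A -> \sum_(i < n) ofR k (lam i) * dot (A (x i)) (T (x i)) = 0].
Proof.
have ip := rdot_inner_product dot_norm.
have dd := rdotxx dot_norm.
have [W0 WD] := W_sub.
have WZ a A : W A -> W (a *: A) by move=> WA; rewrite -[_ *: _]addr0; exact: WD.
split => [bj|[n [x [lam [xT lam0 lam1 xA]]]] A WA a].
  have H0Z a y : H0 y -> H0 (a *: y).
    case: H0_fin => n [b ->] [c ->]; exists (fun i => a * c i).
    by rewrite scaler_sumr; apply: eq_bigr => i _; rewrite scalerA.
  have orthZ a y : orthocomplement dot H0 y -> orthocomplement dot H0 (ofR k a *: y).
    by move=> oy u H0u; rewrite linearZl_LR /= oy // mulr0.
  have orth0 : orthocomplement dot H0 0 by move=> u _; rewrite linear0l.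
  set g := opnorm_on _ _ in T_gap.
  have g0 : 0 <= g by exact: opnorm_on_ge0.
  have lT := T_bounded.1.
  have [||||||||||n [x [lam [xH0 lam0 lam1 xA]]]] :=
      @real_orthogonality_witness R (realify H) (rdot dot) ip T H0 W (g ^+ 2).
  - by move=> a u v; exact: lT.
  - by move=> x; have := opnorm_rdot dot_norm x T_bounded; rewrite T_norm expr1n mul1r.
  - exact: realify_finite_dim.
  (* A nonzero [u] in [H0] is normalised into the unit sphere of [H0], where the norm of [T] is
     attained. *)
  - move=> u H0u; rewrite !dd; have [u0|u0] := eqVneq (normR u) 0.
      by rewrite u0 (normR_eq0 u0) linearK0 // normR0.
    have u_gt0 : 0 < normR u by rewrite lt_def u0 normR_ge0.
    have : unit_sphere H0 (ofR k (normR u)^-1 *: u).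
      split; first exact: H0Z.
      by rewrite /= normRZ ger0_norm ?invr_ge0 ?normR_ge0 // mulVf.
    rewrite -T_attain => -[_]; rewrite T_norm linearKZ // normRZ ger0_norm ?invr_ge0 ?normR_ge0 //.
    by move/(canRL (mulVKf u0)) => ->; rewrite mulr1.
  - by rewrite -(expr1n R 2) ltrXn2r // -T_norm.
  - move=> z zH0; rewrite !dd -exprMn; apply: lerXn2r; rewrite ?nnegrE ?mulr_ge0 ?normR_ge0 //.
    by apply: opnorm_onP => //; exact: rdot_orthocomplement zH0.
  - by split => // a A B WA WB; exact: WD.
  - by move=> A /W_bounded [lA _] a u v; exact: lA.
  - by move=> A /W_bounded bA; exact: bounded_operator_rdot.
  (* A strict contraction [T - A] contradicts orthogonality at the scalar -1. Since [q] may be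
     negative, it is replaced by its maximum with 0 before the square root is taken. *)
  - move=> A q WA q1 hq; have := bj A WA (-1); apply/negP; rewrite T_norm -ltNge.
    pose q' := Num.max q 0.
    have q'0 : 0 <= q' by rewrite le_max lexx orbT.
    have s1 : Num.sqrt q' < 1 by rewrite -sqrtr1 ltr_sqrt // gt_max q1 ltr01.
    apply: le_lt_trans s1; apply: opnorm_le => [|x]; first exact: sqrtr_ge0.
    have -> : (T + -1 *: (A : H -> H)) x = T x - (A x : H).
      by rewrite -[- (A x : H)]scaleN1r.
    rewrite -(@ler_pXn2r _ 2) ?nnegrE ?mulr_ge0 ?normR_ge0 ?sqrtr_ge0 //.
    rewrite exprMn sqr_sqrtr // -!dd.
    by apply: (le_trans (hq x)); rewrite ler_wpM2r ?dd ?sqr_ge0 // le_max lexx.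
  exists n, x, lam; split => // [i|A WA].
    rewrite T_attain; have [H0x x1] := xH0 i; split => //=.
    by apply/eqP; rewrite -(@pexpr_eq1 _ _ 2) ?normR_ge0 // -dd x1.
  (* The real identity holds for every [w *: A] in [W], which gives the vanishing of the full scalar
     sum. *)
  apply: ReK_mul_eq0 => w; rewrite mulr_sumr ReK_sum -[RHS](xA (w *: A) (WZ _ _ WA)).
  apply: eq_bigr => i _; rewrite mulrCA ReKM; congr (_ * _).
  by rewrite /rdot -linearZl_LR.
have bA := W_bounded A WA.
have bB := bounded_operators_add_scale a T_bounded bA.
rewrite T_norm.
have op0 : 0 <= opnorm (T + a *: A) by exact: opnorm_on_ge0.
rewrite -(@ler_pXn2r _ 2) ?nnegrE // expr1n -lam1.
have -> : opnorm (T + a *: A) ^+ 2 = \sum_i lam i * opnorm (T + a *: A) ^+ 2.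
  by rewrite -mulr_suml lam1 mul1r.
(* The cross terms average to zero by [xA] applied to [a *: A]. It then suffices to bound each term,
   where [1 + 2 Re] is the squared norm of [(T + a *: A) (x i)] less that of [a *: A (x i)]. *)
have -> : \sum_i lam i = \sum_i lam i * (1 + 2 * rdot dot (a *: A (x i)) (T (x i))).
  under [RHS]eq_bigr do rewrite mulrDr mulr1 mulrCA.
  rewrite big_split /= -mulr_sumr.
  have -> : \sum_i lam i * rdot dot (a *: A (x i)) (T (x i)) =
      ReK (\sum_i ofR k (lam i) * dot ((a *: A) (x i)) (T (x i))).
    by rewrite ReK_sum; apply: eq_bigr => i _; rewrite ReKM.
  by rewrite xA ?ReK0 ?mulr0 ?addr0 //; exact: WZ.
apply: ler_sum => i _; rewrite ler_pM2l //.
have [x1 Tx1] := xT i.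
have := opnorm_rdot dot_norm (x i) bB; rewrite [rdot dot (x i) _]dd x1 expr1n mulr1.
apply: le_trans.
rewrite -[(T + a *: A) (x i)]/(T (x i) + a *: A (x i)).
have := ip_ge0 ip (a *: A (x i)).
have := dd (T (x i)); rewrite Tx1 T_norm expr1n => Txx.
rewrite (ipDl ip) !(ipDr ip) Txx (ipC ip (T (x i))); lra.
Qed.
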